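(* Let $n\in\mathbb{N}$, let $r_1,\ldots,r_n>0$ be arbitrary, $\mathbf{r}:=(r_1,\ldots,r_n)$ and $R:=\sum_{j=1}^n r_j$. Let $w\colon\mathbb{R}\to[0,\infty)$ be a bounded above function assuming non-zero values at more than $n$ points. Assume that $$\lim_{|x|\to\infty}w(x)\cdot|x|^{R}=0.$$ Then there exists a unique $T\in\mathcal{P}_{\mathbf{r}}$ such that $$\|w(x)T(x)\|=\inf_{P\in\mathcal{P}_{\mathbf{r}}}\|w(x)P(x)\|,$$ where $\|\cdot\|$ is the sup norm over $\mathbb{R}$. All roots of $T$ are real and distinct. Moreover, this extremal polynomial is characterized by an equioscillation property: there exists an array of points $-\infty<t_0<\ldots<t_n<\infty$ such that $$|w(t_k)T(t_k)|=\|wT\|,\quad k=0,\ldots,n.$$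
   Context: The set of monic generalized nonnegative polynomials of degree $R=\sum_{j=1}^n r_j$ (regarded as functions of $x\in\mathbb{R}$) is $$\mathcal{P}_{\mathbf{r}}:=\Big\{\prod_{j=1}^n|x-(x_j+iy_j)|^{r_j}\colon-\infty<x_1<\ldots<x_n<\infty,\ y_1,\ldots,y_n\in\mathbb{R}\Big\}.$$
   Formalization: As printed, equioscillation fails (w = indicator of (-1,1), n=r=1). It is stated with the upper limit of |wT| at t_k for all w, with equality for upper semicontinuous w, and with t_0<x_1<t_1<...<x_n<t_n, x_j the roots of T, as the converse is false without interlacing. *)

(* Defs.v *)
From HB Require Import structures.
From mathcomp Require Import all_boot all_order all_algebra.
From mathcomp Require Import all_classical all_reals all_analysis.
From mathcomp Require Import complex.

Set Implicit Arguments.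
Unset Strict Implicit.
Unset Printing Implicit Defensive.

Import Order.TTheory GRing.Theory Num.Theory.
Import numFieldNormedType.Exports.

Local Open Scope classical_set_scope.
Local Open Scope ring_scope.

Definition strictly_increasing (R : realType) (n : nat) (x : 'I_n -> R) : Prop :=
  forall i j : 'I_n, (i < j)%N -> x i < x j.

(* t |-> \prod_j |t - (x_j + i y_j)| ^ r_j, with the complex modulus. *)
Definition gnpoly (R : realType) (n : nat) (r x y : 'I_n -> R) (t : R) : R :=
  \prod_(j < n) ComplexField.Normc.normc (t%:C - (x j +i* y j))%C `^ r j.

Definition gnpolys (R : realType) (n : nat) (r : 'I_n -> R) : set (R -> R) :=
  [set P | exists x y : 'I_n -> R, strictly_increasing x /\ P = gnpoly r x y].

(* Sup norm over the whole line (not the essential supremum); +oo when the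
   function is unbounded. *)
Definition supnorm (R : realType) (f : R -> R) : \bar R :=
  ereal_sup (range (fun s => (`|f s|)%:E)).

Definition extremal (R : realType) (n : nat) (r : 'I_n -> R) (w T : R -> R) : Prop :=
  gnpolys r T /\
  supnorm (w \* T) = ereal_inf [set supnorm (w \* P) | P in gnpolys r].

Definition upper_semicontinuous (R : realType) (w : R -> R) : Prop :=
  lower_semicontinuous (fun s => (- w s)%:E).

(* s is a point where |f| takes the value ||f||. *)
Definition attains_norm (R : realType) (f : R -> R) (s : R) : Prop :=
  (`|f s|)%:E = supnorm f.

(* s is a point where the upper limit of |f| is ||f||; nbhs s is not punctured,
   so the value at s counts.  For f := w * T with w upper semicontinuous this is
   attains_norm.  Without semicontinuity the supremum need not be attained
   anywhere: for n = 1, r = 1 and w the indicator of ]-1, 1[, the extremal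
   function is |s| and w(s)|s| < 1 = ||w T|| for every s. *)
Definition approaches_norm (R : realType) (f : R -> R) (s : R) : Prop :=
  limf_esup (fun u => (`|f u|)%:E) (nbhs s) = supnorm f.

(* T has real roots x_1 < ... < x_n, and there are n + 1 points t_0 < ... < t_n
   of the set `peak` which alternate with them: t_0 < x_1 < t_1 < ... < x_n < t_n.
   The alternation is what makes the property characteristic: for n = 1, r = 1,
   w(1) = 1, w(2) = 1/2 and w = 0 elsewhere, w(s)|s| takes its maximum 1 at both
   1 and 2, but the extremal function is |s - 4/3|. *)
Definition equioscillates (R : realType) (n : nat) (r : 'I_n -> R) (T : R -> R)
    (peak : R -> Prop) : Prop :=
  exists (x : 'I_n -> R) (t : 'I_n.+1 -> R),
    [/\ strictly_increasing x /\ T = gnpoly r x (fun=> 0),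
        strictly_increasing t,
        forall j : 'I_n, t (widen_ord (leqnSn n) j) < x j < t (lift ord0 j)
      & forall k : 'I_n.+1, peak (t k)].

(* Main.v *)
Require Import Defs.
From mathcomp Require Import all_boot all_order all_algebra.
From mathcomp Require Import all_classical all_reals all_analysis.
From mathcomp Require Import complex ring lra.
Import Order.TTheory GRing.Theory Num.Theory.
Import numFieldNormedType.Exports.
Local Open Scope classical_set_scope.
Local Open Scope ring_scope.

Set Implicit Arguments.
Unset Strict Implicit.
Unset Printing Implicit Defensive.

(* Replacing w by its upper semicontinuous envelope W does not change any norm
   ||wP||, and makes the norm attained.

   An equioscillating T is optimal: let t interlace the roots x of T, let T' have
   real roots x' and suppose T' <= T at every t_k. Let z_j be x'_j clamped to
   [t_(j-1), t_j]. By Lagrange interpolation,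
   prod_j (s - z_j) / prod_k (s - t_k) = sum_k lam_k / (s - t_k), and interlacing
   makes every lam_k nonnegative. Let G(s) = sum_k lam_k ln |s - t_k|. The sign of
   G' shows that G(x_j) <= G(x'_j), strictly if x_j <> x'_j, whereas
   sum_j r_j (G(x'_j) - G(x_j)) = sum_k lam_k (ln T'(t_k) - ln T(t_k)) <= 0.
   Hence x' = x. Imaginary parts only increase T'.

   An equioscillating T exists: minimize the norm over nondecreasing root vectors.
   If two roots coincide, or if some gap between consecutive roots contains no
   point where W T attains its maximum, then spreading the two roots apart (or
   pushing an extreme root inwards) lowers W T near all its maximum points. *)

(** * Interlacing and comparison of generalized polynomials *)

(** Both sides have degree at most n in [s] and agree at the n + 1 nodes: at [t m] every term but
    the m-th vanishes. *)
Lemma lagrange_prod (F : fieldType) (n : nat) (t : 'I_n.+1 -> F)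
    (z : 'I_n -> F) (s : F) : injective t ->
  \prod_(j < n) (s - z j) =
  \sum_(k < n.+1) (\prod_(j < n) ((t k - z j) / (t k - t (lift k j)))) *
                  \prod_(j < n) (s - t (lift k j)).
Proof.
move=> t_inj; set lam := fun k => \prod_(j < n) ((t k - z j) / (t k - t (lift k j))).
pose P := \prod_(j < n) ('X - (z j)%:P).
pose Q (k : 'I_n.+1) := \prod_(j < n) ('X - (t (lift k j))%:P).
have sizeP : size P = n.+1.
  by rewrite size_prod_XsubC /index_enum -enumT size_enum_ord.
have sizeQ k : size (Q k) = n.+1.
  rewrite /Q -(big_map (fun j => t (lift k j)) xpredT (fun x => 'X - x%:P)).
  by rewrite size_prod_XsubC size_map /index_enum -enumT size_enum_ord.
suff : P - \sum_k lam k *: Q k = 0.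
  move/(congr1 (horner^~ s)); rewrite hornerD hornerN horner_sum horner0.
  move/eqP; rewrite subr_eq0 => /eqP; rewrite horner_prod.
  under eq_bigr do rewrite hornerXsubC.
  move=> ->; apply: eq_bigr => k _; rewrite hornerZ horner_prod.
  by under eq_bigr do rewrite hornerXsubC.
apply: (@roots_geq_poly_eq0 _ _ [seq t k | k <- enum 'I_n.+1]).
- apply/allP => _ /mapP[m _ ->]; rewrite rootE hornerD hornerN horner_sum.
  rewrite (bigD1 m) //= big1 => [|k km].
    rewrite addr0 hornerZ !horner_prod subr_eq0 /lam -big_split/=.
    apply/eqP/eq_bigr => j _; rewrite !hornerXsubC divfK // subr_eq0.
    by rewrite (inj_eq t_inj) neq_lift.
  case: (unliftP k m) km => [j ->|->]; last by rewrite eqxx.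
  by rewrite hornerZ horner_prod (bigD1 j) //= hornerXsubC subrr mul0r mulr0.
- by rewrite map_inj_uniq // enum_uniq.
- rewrite size_map size_enum_ord (leq_trans (size_polyD _ _)) // geq_max sizeP.
  rewrite leqnn size_polyN (leq_trans (size_sum _ _ _)) //.
  by apply/bigmax_leqP => k _; rewrite (leq_trans (size_scale_leq _ _)) // sizeQ.
Qed.

Lemma lagrange_fraction (F : fieldType) (n : nat) (t : 'I_n.+1 -> F)
    (z : 'I_n -> F) (s : F) : injective t -> (forall k, s != t k) ->
  \sum_(k < n.+1) (\prod_(j < n) ((t k - z j) / (t k - t (lift k j)))) / (s - t k) =
  (\prod_(j < n) (s - z j)) / \prod_(k < n.+1) (s - t k).
Proof.
move=> t_inj st; rewrite (@lagrange_prod _ _ t) // mulr_suml.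
apply: eq_bigr => k _; rewrite -mulrA; congr (_ * _).
rewrite (bigD1_ord k) //= invfM mulrCA mulfV ?mulr1 //.
by apply/prodf_neq0 => j _; rewrite subr_eq0.
Qed.

Lemma strictly_increasing_inj (R : realType) (m : nat) (x : 'I_m -> R) :
  strictly_increasing x -> injective x.
Proof.
move=> x_incr i j xij; apply/val_inj; case: (ltngtP i j) => // /x_incr.
  by rewrite xij ltxx.
by rewrite xij ltxx.
Qed.

Lemma interlacing_le (R : realType) (n : nat) (t : 'I_n.+1 -> R) (k l : 'I_n.+1) :
  strictly_increasing t -> (k <= l)%N -> t k <= t l.
Proof.
move=> t_incr; rewrite leq_eqVlt => /predU1P[/val_inj->//|kl].
exact/ltW/t_incr.
Qed.

Definition clamp (R : realType) (a b x : R) : R := Num.max a (Num.min b x).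

Lemma clamp_ge (R : realType) (a b x : R) : a <= clamp a b x.
Proof. by rewrite le_max lexx. Qed.

Lemma clamp_le (R : realType) (a b x : R) : a <= b -> clamp a b x <= b.
Proof. by move=> ab; rewrite ge_max ab ge_min lexx. Qed.

Section interlacing.
Context (R : realType) (n : nat) (t : 'I_n.+1 -> R) (x x' : 'I_n -> R).
Hypothesis t_incr : strictly_increasing t.
Hypothesis tx : forall j : 'I_n, t (widen_ord (leqnSn n) j) < x j < t (lift ord0 j).
Hypothesis x'_ndecr : forall i j : 'I_n, (i <= j)%N -> x' i <= x' j.

(** [tw j] and [tl j] are the nodes next to [x j] on the left and on the right; [D] is the
    derivative G' of G(s) = sum_k lam_k ln |s - t_k|. *)
Let tw (j : 'I_n) := t (widen_ord (leqnSn n) j).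
Let tl (j : 'I_n) := t (lift ord0 j).
Let z (j : 'I_n) := clamp (tw j) (tl j) (x' j).
Let lam (k : 'I_n.+1) := \prod_(j < n) ((t k - z j) / (t k - t (lift k j))).
Let D (s : R) := \sum_(k < n.+1) lam k / (s - t k).

Let t_inj : injective t. Proof. exact: strictly_increasing_inj. Qed.

Let tw_lt_tl j : tw j < tl j. Proof. by apply: t_incr => /=; rewrite /bump. Qed.
Let tw_le_z j : tw j <= z j. Proof. exact: clamp_ge. Qed.
Let z_le_tl j : z j <= tl j. Proof. exact/clamp_le/ltW/tw_lt_tl. Qed.

(** For j < k, [lift k j] is j and z_j <= [tl j] <= t_k; for j >= k it is j + 1 and t_k <= [tw j] <=
    z_j. So numerator and denominator of each factor agree in sign. *)
Lemma interlacing_weight_ge0 k : 0 <= lam k.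
Proof.
apply: prodr_ge0 => j _; case: (ltnP j k) => jk.
  have -> : lift k j = widen_ord (leqnSn n) j.
    by apply/val_inj; rewrite /= /bump leqNgt jk.
  rewrite divr_ge0 // subr_ge0; last exact/ltW/t_incr.
  by rewrite (le_trans (z_le_tl j)) // interlacing_le.
have -> : lift k j = lift ord0 j by apply/val_inj; rewrite /= /bump jk.
rewrite -mulrNN -invrN divr_ge0 // oppr_ge0 subr_le0.
  by rewrite (le_trans _ (tw_le_z j)) // interlacing_le.
by apply/ltW/t_incr; rewrite /= /bump /= ltnS.
Qed.

Lemma interlacing_weight_eq0 k j : z j = t k -> lam k = 0.
Proof. by move=> zj; rewrite /lam (bigD1 j) //= zj subrr !mul0r. Qed.

(* A node separating x_i from x'_i (or equal to x'_i) carries no weight. *)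
Lemma interlacing_weight_same_side i k : lam k != 0 ->
  0 < (x i - t k) / (x' i - t k).
Proof.
move=> lamk; case: (ltnP i k) => ik.
  have xt : x i < t k.
    have /andP[_ /lt_le_trans] := tx i; apply.
    by apply: interlacing_le.
  rewrite -mulrNN -invrN !opprB divr_gt0 ?subr_gt0// ltNge.
  (* If [x' i] lay at or beyond [t k], so would the root of index k - 1 >= i, whose clamping
     interval ends at [t k]; it would be clamped to [t k] and cancel the weight. The other case uses
     the root of index k. *)
  apply/negP => tx'; case/negP: lamk; apply/eqP.
  have k0 : (0 < k)%N by exact: leq_ltn_trans ik.
  have kn : (k.-1 < n)%N by rewrite -ltnS prednK.
  apply: (@interlacing_weight_eq0 _ (Ordinal kn)); rewrite /z /clamp.
  have -> : tl (Ordinal kn) = t k.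
    by congr t; apply/val_inj; rewrite /= /bump /= add1n prednK.
  have ? : tw (Ordinal kn) <= t k by apply: interlacing_le => //=; rewrite leq_pred.
  rewrite min_l; first by rewrite max_r.
  by rewrite (le_trans tx')// x'_ndecr //= -ltnS prednK.
have xt : t k < x i.
  have /andP[/(le_lt_trans _) + _] := tx i; apply.
  by apply: interlacing_le.
rewrite divr_gt0 ?subr_gt0// ltNge.
apply/negP => tx'; case/negP: lamk; apply/eqP.
have kn : (k < n)%N by exact: leq_ltn_trans (ltn_ord i).
apply: (@interlacing_weight_eq0 _ (Ordinal kn)); rewrite /z /clamp.
have tk : tw (Ordinal kn) = t k by congr t; apply/val_inj.
rewrite tk max_l// ge_min; apply/orP; right.
by rewrite (le_trans _ tx')// x'_ndecr.
Qed.

(** Were all weights zero, prod_j (s - z_j) would vanish identically, yet it is nonzero to the right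
    of all nodes. *)
Lemma interlacing_weight_neq0 : exists k, lam k != 0.
Proof.
apply/existsP; rewrite -[[exists _, _]]negbK; apply/negP; rewrite negb_exists.
move=> /forallP lam0.
have := lagrange_prod z (t ord_max + 1) t_inj.
rewrite [RHS]big1 => [/eqP|k _]; last first.
  by have := lam0 k; rewrite negbK => /eqP lamk; rewrite -/(lam k) lamk mul0r.
rewrite prodf_seq_eq0 => /hasP[j _ /= /eqP zj].
have : z j < t ord_max + 1.
  by rewrite (le_lt_trans (z_le_tl j)) // ltr_pwDr ?ltr01 // interlacing_le // -ltnS ltn_ord.
by rewrite -subr_gt0 zj ltxx.
Qed.

(** Pairing s - z_j with s - [tl j] leaves the positive factor 1 / (s - t_0). If s <= [tl j], then j
    >= i, so [x' j] >= s and hence z_j >= s: the signs agree in every pair. *)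
Let D_gt (s : R) i : x i < s -> s <= x' i -> (forall k, s != t k) -> 0 <= D s.
Proof.
move=> xs sx' st; rewrite /D lagrange_fraction // big_ord_recl.
rewrite invfM mulrCA mulr_ge0 //.
  rewrite invr_ge0 subr_ge0 ltW // (le_lt_trans _ xs) //.
  have /andP[/ltW + _] := tx i; apply: le_trans.
  exact: interlacing_le.
rewrite -prodf_div; apply: prodr_ge0 => j _.
case: (ltP (tl j) s) => ts.
  by rewrite divr_ge0// subr_ge0 ltW// (le_lt_trans (z_le_tl j)).
rewrite -mulrNN -invrN divr_ge0 // oppr_ge0 subr_le0 //.
rewrite /z /clamp le_max le_min ts /=; apply/orP; right.
rewrite (le_trans sx')// x'_ndecr// leqNgt; apply/negP => ji.
suff : s < s by rewrite ltxx.
rewrite (le_lt_trans ts)// (le_lt_trans _ xs)//.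
have /andP[/ltW + _] := tx i; apply: le_trans.
by apply: interlacing_le.
Qed.

(** Mirror image: s - z_j is paired with s - [tw j], leaving the negative factor 1 / (s - t_n). *)
Let D_lt (s : R) i : s < x i -> x' i <= s -> (forall k, s != t k) -> D s <= 0.
Proof.
move=> xs sx' st; rewrite /D lagrange_fraction // big_ord_recr /=.
rewrite invfM mulrA mulr_ge0_le0 //; last first.
  rewrite invr_le0 subr_le0 ltW // (lt_le_trans xs) //.
  have /andP[_ /ltW] := tx i => /le_trans; apply.
  by apply: interlacing_le => //; exact: ltn_ord.
rewrite -prodf_div; apply: prodr_ge0 => j _.
case: (ltP s (tw j)) => ts.
  rewrite -mulrNN -invrN divr_ge0 // oppr_ge0 subr_le0 ltW //.
  by rewrite (lt_le_trans ts).
rewrite divr_ge0// subr_ge0//.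
rewrite /z /clamp ge_max ts ge_min; apply/orP; right.
rewrite (le_trans _ sx')// x'_ndecr// leqNgt; apply/negP => ji.
suff : s < s by rewrite ltxx.
rewrite (lt_le_trans _ ts)// (lt_le_trans xs)//.
have /andP[_ /ltW] := tx i => /le_trans; apply.
by apply: interlacing_le.
Qed.

(** If [x' i] is a node, that node has weight zero and its term is constantly 0. *)
Let D_cvg i : D s @[s --> x' i] --> D (x' i).
Proof.
rewrite /D; apply: cvg_big => [|k _]; first exact: add_continuous.
have [->|lamk] := eqVneq (lam k) 0.
  by under eq_fun do rewrite mul0r; rewrite mul0r; exact: cvg_cst.
apply: cvgMl_tmp; apply: cvgV; last by apply: cvgB; [exact: cvg_id|exact: cvg_cst].
have := interlacing_weight_same_side i lamk; apply: contraTneq => ->.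
by rewrite invr0 mulr0 ltxx.
Qed.

(** The factored form of [D] excludes the nodes, and [x' i] may be one; the sign is found at points
    approaching [x' i] from the side of [x i] and passes to the limit. *)
Let D_sign i : 0 <= D (x' i) * (x' i - x i).
Proof.
have [xx'|x'x|->] := ltgtP (x i) (x' i); last by rewrite subrr mulr0.
  rewrite mulr_ge0 ?subr_ge0 ?(ltW xx') //.
  have Dl : D s @[s --> (x' i)^'-] --> D (x' i) by exact/cvg_at_left_filter/D_cvg.
  apply: (cvgr_to_ge Dl).
  have st : \forall s \near (x' i)^'-, forall k, s != t k.
    apply: filter_forall => k; case: (ltP (t k) (x' i)) => tk.
      by near=> s; rewrite gt_eqF//; near: s; exact: nbhs_left_gt.
    by near=> s; rewrite lt_eqF// (lt_le_trans _ tk)//; near: s; exact: nbhs_left_lt.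
  near=> s; apply: (@D_gt _ i); near: s => //.
    exact: nbhs_left_gt.
  by apply: filterS (nbhs_left_lt _) => s /ltW.
rewrite mulr_le0 ?subr_le0 ?(ltW x'x) //.
have Dr : D s @[s --> (x' i)^'+] --> D (x' i) by exact/cvg_at_right_filter/D_cvg.
apply: (cvgr_to_le Dr).
have st : \forall s \near (x' i)^'+, forall k, s != t k.
  apply: filter_forall => k; case: (ltP (x' i) (t k)) => tk.
    by near=> s; rewrite lt_eqF//; near: s; exact: nbhs_right_lt.
  by near=> s; rewrite gt_eqF// (le_lt_trans tk)//; near: s; exact: nbhs_right_gt.
near=> s; apply: (@D_lt _ i); near: s => //.
  exact: nbhs_right_lt.
by apply: filterS (nbhs_right_gt _) => s /ltW.
Unshelve. all: by end_near. Qed.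

(** By ln (1 + v) <= v with v = (x_i - x'_i) / (x'_i - t_k), the sum is at most (x_i - x'_i)
    G'(x'_i) <= 0. Strictness comes from v <> 0 at a node of nonzero weight. *)
Lemma interlacing_log_lt0 i : x i != x' i ->
  \sum_(k < n.+1) lam k * ln ((x i - t k) / (x' i - t k)) < 0.
Proof.
move=> xx'.
have ln_le k : lam k * ln ((x i - t k) / (x' i - t k)) <=
               (x i - x' i) * (lam k / (x' i - t k)) ?= iff (lam k == 0).
  have [->|lamk] := eqVneq (lam k) 0; first by rewrite !mul0r mulr0; exact/leif_refl.
  have q0 := interlacing_weight_same_side i lamk.
  have x't : x' i - t k != 0.
    by apply: contraTneq q0 => ->; rewrite invr0 mulr0 ltxx.
  have qE : (x i - t k) / (x' i - t k) = 1 + (x i - x' i) / (x' i - t k) by field.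
  rewrite mulrCA; apply/leifP; rewrite ltr_pM2l; last first.
    by rewrite lt_neqAle eq_sym lamk interlacing_weight_ge0.
  rewrite -(ltrD2l 1) -qE -{2}[_ / _](lnK q0) expR_gt1Dx // ln_eq0 // qE.
  by rewrite -subr_eq0 addrAC subrr add0r mulf_neq0 ?invr_eq0 // subr_eq0.
have : \sum_(k < n.+1) lam k * ln ((x i - t k) / (x' i - t k)) < (x i - x' i) * D (x' i).
  rewrite /D mulr_sumr.
  have := leif_sum (P := xpredT) (fun k _ => ln_le k); move=> le_sum; rewrite (lt_leif le_sum).
  by have [k lamk] := interlacing_weight_neq0; apply/forallPn; exists k.
move=> /lt_le_trans; apply; rewrite -oppr_ge0 -mulNr opprB mulrC; exact: D_sign.
Qed.

Lemma interlacing_prod_le_eq (r : 'I_n -> R) : (forall j, 0 < r j) ->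
  (forall k, \prod_(j < n) `|t k - x' j| `^ r j <=
             \prod_(j < n) `|t k - x j| `^ r j) -> x =1 x'.
Proof.
move=> r_gt0 le_prod i; apply/eqP/negPn/negP => xx'.
(* The double sum is read in two ways: grouped by roots it is negative; grouped by nodes it is a
   nonnegative combination of the differences ln T(t_k) - ln T'(t_k) >= 0. *)
suff : 0 <= \sum_(j < n) r j * \sum_(k < n.+1) lam k * ln ((x j - t k) / (x' j - t k)).
  apply/negP; rewrite -ltNge (bigD1 i) //=.
  have lt0 := interlacing_log_lt0 xx'.
  rewrite -[ltRHS](addr0 0) ltr_leD ?pmulr_rlt0 //.
  apply: sumr_le0 => j _; rewrite pmulr_rle0//.
  have [xj|/interlacing_log_lt0/ltW//] := eqVneq (x j) (x' j).
  apply: sumr_le0 => k _; have [->|lamk] := eqVneq (lam k) 0; first by rewrite mul0r.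
  have := interlacing_weight_same_side j lamk; rewrite xj => q0.
  rewrite divff ?ln1 ?mulr0//.
  by apply: contraTneq q0 => ->; rewrite mul0r ltxx.
under eq_bigr do rewrite mulr_sumr.
rewrite exchange_big /=; apply: sumr_ge0 => k _.
under eq_bigr do rewrite mulrCA.
rewrite -mulr_sumr.
have [->|lamk] := eqVneq (lam k) 0; first by rewrite mul0r.
rewrite mulr_ge0 ?interlacing_weight_ge0//.
have side j := interlacing_weight_same_side j lamk.
have x0 j : 0 < `|t k - x j|.
  by rewrite normr_gt0 -oppr_eq0 opprB; apply: contraTneq (side j) => ->; rewrite mul0r ltxx.
have x'0 j : 0 < `|t k - x' j|.
  rewrite normr_gt0 -oppr_eq0 opprB; apply: contraTneq (side j) => ->.
  by rewrite invr0 mulr0 ltxx.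
have ln_prod (y : 'I_n -> R) : (forall j, 0 < `|t k - y j|) ->
    \sum_(j < n) r j * ln `|t k - y j| = ln (\prod_(j < n) `|t k - y j| `^ r j).
  move=> y0; suff [-> _]: \sum_(j < n) r j * ln `|t k - y j| =
    ln (\prod_(j < n) `|t k - y j| `^ r j) /\ 0 < \prod_(j < n) `|t k - y j| `^ r j by [].
  elim/big_rec2 : _ => [|j a b _ [-> b0]]; first by rewrite ln1.
  by rewrite lnM ?posrE ?powR_gt0 // ln_powR mulr_gt0 ?powR_gt0.
under eq_bigr => j _.
  rewrite -[_ / _]gtr0_norm // normf_div (distrC (x j)) (distrC (x' j)).
  rewrite lnM ?posrE ?invr_gt0 // lnV ?posrE // mulrBr.
  over.
rewrite sumrB subr_ge0 !ln_prod // ler_ln ?posrE //.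
- by apply: prodr_gt0 => j _; exact: powR_gt0.
- by apply: prodr_gt0 => j _; exact: powR_gt0.
Qed.

End interlacing.

(** * The upper semicontinuous envelope *)

(** Without a minimizer, the sets of y in K with f y <= f y0 generate a filter along which f y < f x
    holds near each x of K. Compactness makes this uniform in x, which yields f x < f x for some
    x. *)
Lemma compact_argmin (R : realType) (T : topologicalType) (K : set T) (f : T -> R) :
  compact K -> K !=set0 -> (forall c, open [set x | c < f x]) ->
  exists2 x, K x & forall y, K y -> f x <= f y.
Proof.
move=> /compact_near_coveringP coverK [a Ka] f_lsc; apply: contrapT => nomin.
have {}nomin x : K x -> exists2 y, K y & f y < f x.
  move=> Kx; apply: contrapT => noy; apply: nomin; exists x => // y Ky.
  by rewrite leNgt; apply/negP => fyx; apply: noy; exists y.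
pose F := filter_from K (fun y0 => [set y | K y /\ f y <= f y0]).
have FF : Filter F.
  apply: filter_from_filter; first by exists a.
  move=> i j Ki Kj; case: (leP (f i) (f j)) => fij.
    exists i => // y [Ky fy]; split; split => //; exact: le_trans fij.
  exists j => // y [Ky fy]; split; split => //; exact: le_trans (ltW fij).
have [x Kx] : F (fun y => K `<=` [set x | f y < f x]).
  apply: (coverK _ F (fun y x => f y < f x)) => x Kx; have [y Ky fyx] := nomin _ Kx.
  exists ([set z | f y < f z], [set z | K z /\ f z <= f y]) => /=.
    split; last by exists y.
    by apply: open_nbhs_nbhs; split; [exact: f_lsc|].
  by move=> [u v] /= [fu [Kv fv]]; exact: le_lt_trans fu.
by move=> /(_ x) /= /(_ (conj Kx (lexx _))) /(_ x Kx) /=; rewrite ltxx.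
Qed.

Lemma near_mul_lt (R : realType) (X : Type) (F : set_system X) (g P : X -> R)
    (a b c : R) {FF : Filter F} : 0 <= a -> (forall u, 0 <= g u) -> (forall u, 0 <= P u) ->
  (forall e, a < e -> \forall u \near F, g u < e) -> P u @[u --> F] --> b ->
  0 <= b -> a * b < c -> \forall u \near F, g u * P u < c.
Proof.
move=> a0 g0 P0 g_lt P_cvg b0 abc.
(* (a + d)(b + d) = ab + d(a + b + d), and d <= 1 keeps a + b + d strictly below a + b + 2. *)
pose d := Num.min 1 ((c - a * b) / (a + b + 2)).
have d0 : 0 < d by rewrite lt_min ltr01 divr_gt0 ?subr_gt0 //; lra.
have dc : (a + d) * (b + d) < c.
  have d1 : d <= 1 by rewrite ge_min lexx.
  have : d * (a + b + 2) <= c - a * b.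
    by rewrite -ler_pdivlMr ?ge_min ?lexx ?orbT //; lra.
  by nra.
near=> u; apply: le_lt_trans dc; apply: ler_pM => //; apply: ltW; near: u.
  by apply: g_lt; rewrite ltrDl.
by apply: (cvgr_lt b) => //; rewrite ltrDl.
Unshelve. all: by end_near. Qed.

Lemma usc_vanishing_argmax (R : realType) (g : R -> R) :
  (forall c, open [set s | g s < c]) -> (forall s, 0 <= g s) ->
  (forall e, 0 < e -> exists B, forall s, B < `|s| -> g s <= e) ->
  exists s0, forall s, g s <= g s0.
Proof.
move=> g_usc g0 g_vanish.
have [g_eq0|] := pselect (forall s, g s = 0).
  by exists 0 => s; rewrite !g_eq0.
move=> /existsNP[s1 /eqP gs1]; have {}gs1 : 0 < g s1 by rewrite lt_neqAle eq_sym gs1 g0.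
have [B gB] := g_vanish _ gs1.
pose C := Num.max B `|s1|.
have itvP s : `[- C, C]%classic s <-> `|s| <= C by rewrite /= in_itv/= ler_norml.
have C1 : `[- C, C]%classic s1 by apply/itvP; rewrite le_max lexx orbT.
have [|c|s0 _ min0] := @compact_argmin R _ `[- C, C]%classic (fun s => - g s)
  (@segment_compact _ _ _).
- by exists s1.
- rewrite (_ : [set _ | _] = [set s | g s < - c]) //.
  by apply/seteqP; split=> s /=; rewrite ltrNr.
exists s0 => s; case: (leP `|s| C) => sC.
  by rewrite -lerN2 min0 //; apply/itvP.
have : g s <= g s1 by apply: gB; apply: le_lt_trans sC; rewrite le_max lexx.
by move=> /le_trans; apply; rewrite -lerN2 min0.
Qed.

(** The upper limit of w at s, the value at s included. When w is bounded above, the set is nonempty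
    and bounded below by [w s], so [inf] does not take its default value. *)
Definition usc_envelope (R : realType) (w : R -> R) (s : R) : R :=
  inf [set c | \forall u \near s, w u <= c].

Section envelope.
Context (R : realType) (w : R -> R).
Hypothesis w_ge0 : forall s, 0 <= w s.
Hypothesis w_bounded_above : has_ubound (range w).
Local Notation W := (usc_envelope w).

Let env_lbound (s : R) : lbound [set c | \forall u \near s, w u <= c] (w s).
Proof. by move=> c /= /nbhs_singleton. Qed.

Let env_has_inf (s : R) : has_inf [set c | \forall u \near s, w u <= c].
Proof.
split; last by exists (w s); exact: env_lbound.
have [b wb] := w_bounded_above.
by exists b; near=> u; apply: wb; exists u.
Unshelve. all: by end_near. Qed.

Lemma usc_envelope_ge s : w s <= W s.
Proof. by apply: lb_le_inf; [case: (env_has_inf s)|exact: env_lbound]. Qed.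

Lemma usc_envelope_ge0 s : 0 <= W s.
Proof. exact: le_trans (usc_envelope_ge s). Qed.

Lemma usc_envelope_le (s c : R) : (\forall u \near s, w u <= c) -> W s <= c.
Proof. by move=> wc; apply: ge_inf => //; case: (env_has_inf s). Qed.

Lemma near_lt_usc_envelope (s c : R) : W s < c -> \forall u \near s, w u < c.
Proof.
move=> Wc; have [e /= we ec] := inf_lt (env_has_inf s).1 Wc.
by apply: filterS we => u /le_lt_trans; apply.
Qed.

Lemma usc_envelope_usc (s c : R) : W s < c -> \forall u \near s, W u < c.
Proof.
move=> Wc; have [Wm mc] := midf_lt Wc.
have /near_join := near_lt_usc_envelope Wm.
apply: filterS => u wm; apply: le_lt_trans mc; apply: usc_envelope_le.
by apply: filterS wm => v /ltW.
Qed.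

Section product.
Context (P : R -> R).
Hypothesis P_ge0 : forall s, 0 <= P s.
Hypothesis P_cont : continuous P.

Lemma usc_envelope_mul_lt (s c : R) : W s * P s < c -> \forall u \near s, W u * P u < c.
Proof.
move=> WPc; apply: (near_mul_lt (F := nbhs s) (usc_envelope_ge0 s) _ _ _ _ (P_ge0 s) WPc) => //.
- exact: usc_envelope_ge0.
- by move=> e; exact: usc_envelope_usc.
- exact: P_cont.
Qed.

(** If P s > 0, then w u <= c / P u near s, and c / P u tends to c / P s; if P s = 0, it is enough
    that c >= 0. *)
Lemma usc_envelope_mul_le (s c : R) : (\forall u \near s, w u * P u <= c) -> W s * P s <= c.
Proof.
move=> wPc; have c0 : 0 <= c.
  by have := nbhs_singleton wPc; apply: le_trans; rewrite mulr_ge0.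
have [->|Ps0] := eqVneq (P s) 0; first by rewrite mulr0.
have Ps : 0 < P s by rewrite lt_neqAle eq_sym Ps0 P_ge0.
rewrite -ler_pdivlMr //; apply/ler_addgt0Pr => e e0; apply: usc_envelope_le.
have cP : c / P u @[u --> s] --> c / P s.
  by apply: cvgM; [exact: cvg_cst|apply: cvgV => //; exact: P_cont].
near=> u; apply: (@le_trans _ _ (c / P u)).
  rewrite ler_pdivlMr; first by near: u.
  by near: u; apply: (cvgr_gt (P s)) => //; exact: P_cont.
by apply/ltW; near: u; apply: (cvgr_lt (c / P s)) => //; rewrite ltrDl.
Unshelve. all: by end_near. Qed.

Let wP_ge0 s : 0 <= w s * P s. Proof. exact: mulr_ge0. Qed.
Let WP_ge0 s : 0 <= W s * P s. Proof. by rewrite mulr_ge0 // usc_envelope_ge0. Qed.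

(** The product W P is upper semicontinuous and dominates w P, whence the upper bound; conversely a
    bound for w P on a neighbourhood passes to W P at s. This turns [approaches_norm] into W P
    attaining the norm. *)
Lemma limf_esup_usc_envelope (s : R) :
  limf_esup (fun u => (`|(w \* P) u|)%:E) (nbhs s) = (W s * P s)%:E.
Proof.
apply/eqP; rewrite eq_le; apply/andP; split.
  apply/lee_addgt0Pr => e e0; rewrite -EFinD.
  have : \forall u \near s, w u * P u <= W s * P s + e.
    have : W s * P s < W s * P s + e by rewrite ltrDl.
    move/usc_envelope_mul_lt; apply: filterS => u /ltW; apply: le_trans.
    by rewrite ler_wpM2r // usc_envelope_ge.
  move=> near_le; apply: ereal_inf_le.
  exists (ereal_sup ((fun u => (`|(w \* P) u|)%:E) @` [set u | w u * P u <= W s * P s + e])).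
    by exists [set u | w u * P u <= W s * P s + e].
  by apply: ge_ereal_sup => _ [u /= ue <-]; rewrite lee_fin ger0_norm.
apply: le_ereal_inf_tmp => _ [V Vs <-].
case E : (ereal_sup _) => [c| |]; last 2 first.
- by rewrite leey.
- have := ereal_sup_ubound (ex_intro2 _ _ s (nbhs_singleton Vs) erefl :
    ((fun u => (`|(w \* P) u|)%:E) @` V) _).
  by rewrite E leeNy_eq.
rewrite lee_fin; apply: usc_envelope_mul_le; apply: filterS Vs => u Vu.
rewrite -lee_fin -E -[w u * P u]ger0_norm //; apply: ereal_sup_ubound.
by exists u.
Qed.

(** A global bound is a bound near every point, so it passes to the envelope: w and W give the same
    norms. *)
Lemma supnorm_le (c : R) : (supnorm (w \* P)%R <= c%:E)%E <-> forall s, W s * P s <= c.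
Proof.
split=> [/ereal_supP le_c s|le_c].
  apply: usc_envelope_mul_le; near=> u.
  by have := le_c _ (ex_intro2 _ _ u I erefl); rewrite lee_fin ger0_norm ?wP_ge0.
apply: ge_ereal_sup => _ [s _ <-]; rewrite lee_fin ger0_norm ?wP_ge0 //=.
by rewrite (le_trans _ (le_c s)) // ler_wpM2r // usc_envelope_ge.
Unshelve. all: by end_near. Qed.

Lemma supnorm_argmax (s0 : R) : (forall s, W s * P s <= W s0 * P s0) ->
  supnorm (w \* P) = (W s0 * P s0)%:E.
Proof.
move=> max0; apply/eqP; rewrite eq_le; apply/andP; split; first exact/supnorm_le.
case E : (supnorm _) => [c| |]; last 2 first.
- by rewrite leey.
- have : (supnorm (w \* P)%R <= (-1)%:E)%E by rewrite E leNye.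
  by move/supnorm_le/(_ s0)/(le_trans (WP_ge0 s0)); rewrite ler0N1.
by rewrite lee_fin; move: s0 {max0}; apply/supnorm_le; rewrite E.
Qed.

End product.
End envelope.

(** * Generalized nonnegative polynomials *)

Lemma continuous_norm_powR (R : realType) (r : R) :
  0 < r -> continuous (fun a : R => `|a| `^ r).
Proof.
move=> r0 a; have [->|a0] := eqVneq a 0.
  rewrite /continuous_at normr0 powR0 ?gt_eqF//.
  apply/cvgrPdist_lt => e e0; near=> b.
  rewrite sub0r normrN ger0_norm ?powR_ge0 //.
  have -> : e = (e `^ r^-1) `^ r by rewrite -powRrM mulVf ?gt_eqF// powRr1 // ltW.
  rewrite gt0_ltr_powR ?nnegrE ?powR_ge0//.
  by near: b; exact: (@nbhs0_lt R R _ (powR_gt0 r^-1 e0)).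
have na0 : 0 < `|a| by rewrite normr_gt0.
suff : expR (r * ln `|b|) @[b --> a] --> expR (r * ln `|a|).
  rewrite /continuous_at {2}/powR gt_eqF // => cvgE; apply: cvg_trans cvgE.
  apply: near_eq_cvg; near=> b; rewrite /powR gt_eqF // normr_gt0.
  by near: b; exact: (cvgr_neq0 a (@cvg_id _ _) a0).
apply: continuous_cvg; first exact: continuous_expR.
apply: cvgMl_tmp; apply: continuous_cvg; first exact: continuous_ln.
exact: norm_continuous.
Unshelve. all: by end_near. Qed.

Lemma continuous_prod_norm_powR (R : realType) (T : topologicalType) (n : nat)
    (r : 'I_n -> R) (f : 'I_n -> T -> R) :
  (forall j, 0 < r j) -> (forall j, continuous (f j)) ->
  continuous (fun p => \prod_(j < n) `|f j p| `^ r j).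
Proof.
move=> r_gt0 f_cont; apply: continuous_big; first exact: mul_continuous.
move=> j _ p; apply: (@continuous_comp _ _ _ (f j) (fun a => `|a| `^ r j)).
  exact: f_cont.
exact: continuous_norm_powR.
Qed.

Lemma normc_sub_ge (R : realType) (t x y : R) :
  `|t - x| <= ComplexField.Normc.normc (t%:C - (x +i* y))%C ?= iff (y == 0).
Proof.
rewrite /= sub0r sqrrN -sqrtr_sqr; split.
  by rewrite ler_sqrt ?addr_ge0 ?sqr_ge0 // lerDl sqr_ge0.
rewrite eqr_sqrt ?addr_ge0 ?sqr_ge0 //.
by rewrite -subr_eq0 opprD addrA subrr add0r oppr_eq0 sqrf_eq0.
Qed.

Section gnpoly.
Context (R : realType) (n : nat) (r : 'I_n -> R).
Hypothesis r_gt0 : forall j, 0 < r j.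

Lemma gnpoly_realE (x : 'I_n -> R) (t : R) :
  gnpoly r x (fun=> 0) t = \prod_(j < n) `|t - x j| `^ r j.
Proof.
by apply: eq_bigr => j _; congr powR; apply/esym/eqP; rewrite normc_sub_ge eqxx.
Qed.

Lemma gnpoly_ge0 (x y : 'I_n -> R) (t : R) : 0 <= gnpoly r x y t.
Proof. by apply: prodr_ge0 => j _; exact: powR_ge0. Qed.

Lemma gnpoly_real_gt0 (x : 'I_n -> R) (t : R) :
  (forall j, t != x j) -> 0 < gnpoly r x (fun=> 0) t.
Proof.
by move=> tx; rewrite gnpoly_realE; apply: prodr_gt0 => j _; rewrite powR_gt0 // normr_gt0 subr_eq0.
Qed.

Lemma gnpoly_real_root (x : 'I_n -> R) (t : R) :
  gnpoly r x (fun=> 0) t != 0 -> forall j, t != x j.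
Proof.
rewrite gnpoly_realE => + j; apply: contra_neq => ->.
by rewrite (bigD1 j) //= subrr normr0 powR0 ?gt_eqF // mul0r.
Qed.

Lemma gnpoly_continuous (x y : 'I_n -> R) : continuous (gnpoly r x y).
Proof.
have -> : gnpoly r x y =
    fun t => \prod_(j < n) `|Num.sqrt ((t - x j) ^+ 2 + (y j) ^+ 2)| `^ r j.
  apply/funext => t; apply: eq_bigr => j _.
  by rewrite ger0_norm ?sqrtr_ge0 //= sub0r sqrrN.
apply: continuous_prod_norm_powR => // j t.
apply: continuous_cvg; first exact: sqrt_continuous.
apply: cvgD; last exact: cvg_cst.
have subx : u - x j @[u --> t] --> t - x j by apply: cvgB; [exact: cvg_id|exact: cvg_cst].
exact: (cvgM subx subx).
Qed.

Let factor_le (x y : 'I_n -> R) (t : R) (j : 'I_n) :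
  `|t - x j| `^ r j <= ComplexField.Normc.normc (t%:C - (x j +i* y j))%C `^ r j.
Proof.
have le_normc := (normc_sub_ge t (x j) (y j)).1.
by rewrite ge0_ler_powR ?nnegrE ?(le_trans _ le_normc) // ltW.
Qed.

Lemma gnpoly_real_le (x y : 'I_n -> R) (t : R) :
  gnpoly r x (fun=> 0) t <= gnpoly r x y t.
Proof.
rewrite gnpoly_realE; apply: ler_prod => j _; rewrite powR_ge0 /=.
exact: factor_le.
Qed.

Lemma gnpoly_real_lt (x y : 'I_n -> R) (t : R) (i : 'I_n) :
  (forall j, t != x j) -> y i != 0 -> gnpoly r x (fun=> 0) t < gnpoly r x y t.
Proof.
move=> tx yi; rewrite gnpoly_realE /gnpoly !(bigD1 (P := xpredT) i) //=.
apply: (@lt_le_trans _ _ (ComplexField.Normc.normc (t%:C - (x i +i* y i))%C `^ r i *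
    \prod_(j < n | j != i) `|t - x j| `^ r j)).
  rewrite ltr_pM2r.
    rewrite gt0_ltr_powR ?nnegrE ?(le_trans _ (normc_sub_ge _ _ _).1) //.
    by rewrite lt_neqAle (normc_sub_ge _ _ _).2 (normc_sub_ge _ _ _).1 yi.
  by apply: prodr_gt0 => j _; rewrite powR_gt0 // normr_gt0 subr_eq0.
rewrite ler_wpM2l ?powR_ge0 //; apply: ler_prod => j _; rewrite powR_ge0 /=.
exact: factor_le.
Qed.

End gnpoly.

(** * Minimization over the roots *)

(** Unlike strict monotonicity this is a closed condition, so a minimizer exists; its roots are
    shown to be distinct afterwards. *)
Definition nondecreasing_roots (R : realType) (n : nat) (x : 'I_n -> R) : Prop :=
  forall i j : 'I_n, (i <= j)%N -> x i <= x j.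

Lemma near_injective_gap (R : realType) (m : nat) (p : 'I_m -> R) :
  injective p -> \forall d \near 0^'+, forall k l : 'I_m, k != l -> 2 * d < `|p k - p l|.
Proof.
move=> p_inj; apply: filter_forall => k; apply: filter_forall => l.
have [->|kl] := eqVneq k l; first by apply: nearW.
near=> d => _; rewrite -ltr_pdivlMl // mulrC; near: d; apply: nbhs_right_lt.
by rewrite divr_gt0 // normr_gt0 subr_eq0 (inj_eq p_inj).
Unshelve. all: by end_near. Qed.

(* Pigeonhole: n points cannot come close to n + 1 separated ones. *)
Lemma far_node (R : realType) (n : nat) (p : 'I_n.+1 -> R) (x : 'I_n -> R) (d : R) :
  (forall k l, k != l -> 2 * d < `|p k - p l|) -> exists k, forall j, d <= `|p k - x j|.
Proof.
move=> p_sep; apply: contrapT => /forallNP near_x.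
have {}near_x k : exists j, `|p k - x j| < d.
  by have /existsNP[j /negP] := near_x k; rewrite -ltNge; exists j.
have [f fx] := choice near_x.
have /injectivePn[k [l kl fkl]] : ~~ injectiveb (f : 'I_n.+1 -> 'I_n).
  by apply/negP => /injectiveP/leq_card; rewrite !card_ord ltnn.
have := p_sep _ _ kl; rewrite ltNge => /negP; apply; apply: ltW.
have -> : p k - p l = (p k - x (f k)) - (p l - x (f k)) by ring.
rewrite (le_lt_trans (ler_normB _ _)) // mulr_natl mulr2n.
by apply: ltrD; [exact: fx|rewrite fkl; exact: fx].
Qed.

Section minimization.
Context (R : realType) (n : nat) (r : 'I_n -> R) (W : R -> R) (p : 'I_n.+1 -> R).
Hypothesis r_gt0 : forall j, 0 < r j.
Hypothesis W_ge0 : forall s, 0 <= W s.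
Hypothesis W_usc : forall s c : R, W s < c -> \forall u \near s, W u < c.
Hypothesis W_vanish : forall C e : R, 0 < e ->
  exists B : R, forall x : 'I_n -> R, (forall j, `|x j| <= C) ->
    forall s, B < `|s| -> W s * gnpoly r x (fun=> 0) s <= e.
Hypothesis p_inj : injective p.
Hypothesis Wp_gt0 : forall k, 0 < W (p k).

Local Notation T x := (gnpoly r x (fun=> 0)).

Let WT_argmax (x : 'I_n -> R) : exists s0, forall s, W s * T x s <= W s0 * T x s0.
Proof.
apply: usc_vanishing_argmax => [c|s|e e0].
- rewrite openE => s /= WTc.
  apply: (near_mul_lt (F := nbhs s) (W_ge0 s) _ _ _ _ _ WTc) => //.
  + exact: gnpoly_ge0.
  + by move=> a; exact: W_usc.
  + exact: gnpoly_continuous.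
  + exact: gnpoly_ge0.
- by rewrite mulr_ge0 // gnpoly_ge0.
have [B WB] := W_vanish (\sum_j `|x j|) e0.
by exists B => s; apply: WB => j; rewrite (bigD1 j) //= lerDl sumr_ge0.
Qed.

Let peak : ('I_n -> R) -> R := projT1 (choice WT_argmax).
(** The norm of [W] times [T x] as a real number, read off at a chosen maximum point [peak x]. *)
Let M (x : 'I_n -> R) : R := W (peak x) * T x (peak x).

Let le_M x s : W s * T x s <= M x.
Proof. exact: (projT2 (choice WT_argmax)). Qed.

(** Since [d] does not depend on x, the value at the node [p k] bounds [M x] below uniformly. *)
Let separation : exists2 d : R, 0 < d & forall x : 'I_n -> R,
  exists k, (forall j, d <= `|p k - x j|) /\ d <= W (p k).
Proof.
have : \forall d \near (0 : R)^'+, forall k, d < W (p k).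
  by apply: filter_forall => k; exact: nbhs_right_lt.
move=> /(filterI (near_injective_gap p_inj)) /(filterI (nbhs_right_gt 0)).
move=> /filter_ex[d [d0 [dp dW]]]; exists d => // x.
by have [k kx] := far_node x dp; exists k; split => //; exact/ltW.
Qed.

Let M_gt0 x : 0 < M x.
Proof.
have [d d0 /(_ x)[k [kx _]]] := separation.
apply: (lt_le_trans _ (le_M x (p k))); rewrite mulr_gt0 //.
apply: gnpoly_real_gt0 => j; rewrite -subr_eq0 -normr_gt0.
exact: lt_le_trans (kx j).
Qed.

Let M_coercive : exists B : R, forall x, M x <= M (fun=> 0) -> forall j, `|x j| <= B.
Proof.
have [d d0 sep] := separation.
(* At a node far from all roots, [q i] bounds from below W times all factors but the i-th. [b i]
   solves q_i b^(r_i) = M 0 + 1, so a root beyond the bound forces M x > M 0. *)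
pose q (i : 'I_n) := d * \prod_(j < n | j != i) d `^ r j.
have q0 i : 0 < q i by rewrite mulr_gt0 // prodr_gt0 // => j _; rewrite powR_gt0.
pose b i := ((M (fun=> 0) + 1) / q i) `^ (r i)^-1.
exists (\sum_k `|p k| + \sum_i b i) => x xM i; rewrite leNgt; apply/negP => xi.
have [k [kx dW]] := sep x.
have bi : b i <= `|p k - x i|.
  rewrite distrC (le_trans _ (lerB_dist _ _)) // lerBrDr (le_trans _ (ltW xi)) //.
  rewrite addrC lerD //.
    by rewrite [leRHS](bigD1 k) //= lerDl sumr_ge0.
  by rewrite [leRHS](bigD1 i) //= lerDl sumr_ge0 // => j _; exact: powR_ge0.
have : q i * b i `^ r i <= M x.
  apply: le_trans (le_M x (p k)); rewrite gnpoly_realE (bigD1 i) //= /q -mulrA.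
  apply: ler_pM => //; first exact: ltW.
    by rewrite mulr_ge0 ?powR_ge0 // prodr_ge0 // => j _; rewrite powR_ge0.
  rewrite mulrC ler_pM ?powR_ge0 //.
  - by rewrite prodr_ge0 // => j _; rewrite powR_ge0.
  - by rewrite ge0_ler_powR ?nnegrE ?powR_ge0 // ltW.
  - apply: ler_prod => j _; rewrite powR_ge0 /=.
    by rewrite ge0_ler_powR ?nnegrE ?(ltW d0) // ltW.
rewrite /b -powRrM mulVf ?gt_eqF // powRr1; last first.
  by rewrite divr_ge0 ?(ltW (q0 i)) // addr_ge0 // ltW.
rewrite mulrCA divff ?gt_eqF // mulr1 => /le_trans/(_ xM).
by rewrite gerDl ler10.
Qed.

Section compactness.
Import ArrowAsProduct.

(** [M] is a supremum of functions continuous in x: keeping the point [peak x] fixed while the roots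
    vary shows M > c nearby. *)
Let M_lsc c : open [set x : 'I_n -> R | c < M x].
Proof.
rewrite openE => x /= cM.
have T_cont s : continuous (fun x : 'I_n -> R => T x s).
  have -> : (fun x : 'I_n -> R => T x s) = fun x => \prod_(j < n) `|s - x j| `^ r j.
    by apply/funext => y; rewrite gnpoly_realE.
  apply: (continuous_prod_norm_powR
    (f := fun j (x : prod_topology (fun=> R)) => s - x j)) => // j y.
  have proj_j : (x : prod_topology (fun=> R)) j @[x --> y] --> y j.
    exact: (@proj_continuous _ (fun=> R) j).
  apply: (@cvgB _ _ _ (nbhs y)).
    exact: cvg_cst.
  exact: proj_j.
near=> y; apply: lt_le_trans (le_M y (peak x)); near: y.
apply: (cvgr_gt (M x)) => //; apply: cvgMl_tmp; exact: T_cont.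
Unshelve. all: by end_near. Qed.

Lemma exists_minimizer : exists2 x : 'I_n -> R, nondecreasing_roots x &
  forall x', nondecreasing_roots x' -> M x <= M x'.
Proof.
have [B xB] := M_coercive.
(* Outside the box [K], [M] exceeds its value at the zero vector, which lies in [K]; so minimizing
   within [K] is enough. *)
pose K := [set x : 'I_n -> R | forall j, `[- B, B]%classic (x j)].
have K_compact : compact K.
  by apply: (@tychonoff _ (fun=> R) (fun=> `[- B, B]%classic)) => j; exact: segment_compact.
have nd_closed : closed [set x : 'I_n -> R | nondecreasing_roots x].
  rewrite -[X in closed X]setCK; apply: open_closedC; rewrite openE => x /= x_nd.
  have [i [j [ij xij]]] : exists i j : 'I_n, (i <= j)%N /\ x j < x i.
    apply: contrapT => noij; apply: x_nd => i j ij; rewrite leNgt; apply/negP => xij.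
    by apply: noij; exists i, j.
  have proj_k k : (y : prod_topology (fun=> R)) k @[y --> x] --> x k.
    exact: (@proj_continuous _ (fun=> R) k).
  have diff_cvg : (y : prod_topology (fun=> R)) i - y j @[y --> x] --> x i - x j.
    by apply: (@cvgB _ _ _ (nbhs x)); exact: proj_k.
  have near_ij : \forall y \near x, 0 < y i - y j.
    by apply: (cvgr_gt (x i - x j) diff_cvg); rewrite subr_gt0.
  by apply: filterS near_ij => y yij /(_ _ _ ij); rewrite leNgt -subr_gt0 yij.
have [|||x [Kx x_nd] x_min] := @compact_argmin R _ (K `&` [set x | nondecreasing_roots x]) M.
- exact: compact_closedI.
- exists (fun=> 0); split => // j; rewrite /= in_itv /= -ler_norml.
  exact: (xB (fun=> 0) (lexx _) j).
- exact: M_lsc.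
exists x; first exact: x_nd.
move=> x' x'_nd; have [x'0|x'0] := leP (M x') (M (fun=> 0)).
  by apply: x_min; split => // j; rewrite /= in_itv /= -ler_norml; exact: xB.
apply: le_trans (ltW x'0); apply: x_min; split => // j; rewrite /= in_itv /= -ler_norml.
exact: (xB (fun=> 0) (lexx _) j).
Qed.

End compactness.

(** * Perturbation of the roots *)

Lemma gnpoly_shift_lt (x d : 'I_n -> R) (h u : R) (i : 'I_n) :
  (forall j, u != x j) -> 0 < h -> d i != 0 ->
  (forall j, 0 < 1 - h * d j / (u - x j)) -> 0 <= \sum_j r j * d j / (u - x j) ->
  T (fun j => x j + h * d j) u < T x u.
Proof.
(* Moving each root by h d_j multiplies T(u) by prod_j q_j^(r_j). Since ln q <= q - 1, strictly
   where d_j <> 0, the logarithm of this factor is below -h sum_j r_j d_j / (u - x_j) <= 0; no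
   higher-order error arises. *)
move=> ux h0 di q0 sum0; pose q j := 1 - h * d j / (u - x j).
have ux0 j : u - x j != 0 by rewrite subr_eq0.
have qE : T (fun j => x j + h * d j) u = T x u * \prod_(j < n) q j `^ r j.
  rewrite !gnpoly_realE -big_split /=; apply: eq_bigr => j _.
  rewrite -[X in _ * X `^ _]ger0_norm ?(ltW (q0 j)) // -powRM // -normrM /q.
  by congr (`| _ | `^ _); have := ux0 j => ?; field.
have -> : T x u = T x u * 1 by rewrite mulr1.
rewrite qE ltr_pM2l ?gnpoly_real_gt0 //.
rewrite (_ : \prod_(j < n) _ = expR (\sum_(j < n) r j * ln (q j))); last first.
  by rewrite expR_sum; apply: eq_bigr => j _; rewrite /powR gt_eqF ?q0.
rewrite expR_lt1.
have : \sum_(j < n) r j * ln (q j) < \sum_(j < n) r j * (q j - 1).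
  have ln_le j : r j * ln (q j) <= r j * (q j - 1).
    by rewrite ler_pM2l // -{1}[q j](subrKC 1) le_ln1Dx // ltrBrDl subrr q0.
  rewrite (bigD1 i) //= [ltRHS](bigD1 i) //= ltr_leD ?ler_sum // ltr_pM2l //.
  rewrite -(ltrD2l 1) subrKC -{2}[q i](lnK (q0 i)) expR_gt1Dx // ln_eq0 ?q0 //.
  by rewrite /q -subr_eq0 addrAC subrr add0r oppr_eq0 !mulf_neq0 ?invr_eq0 // gt_eqF.
move=> /lt_le_trans; apply.
rewrite (_ : \sum_(j < n) _ = - (h * \sum_j r j * d j / (u - x j))).
  by rewrite oppr_le0 mulr_ge0 // ltW.
rewrite mulr_sumr -sumrN; apply: eq_bigr => j _; rewrite /q.
by have := ux0 j => ?; field.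
Qed.

Lemma gnpoly_shift_continuous (x d : 'I_n -> R) :
  continuous (fun v : R * R => T (fun j => x j + v.2 * d j) v.1).
Proof.
under eq_fun do rewrite gnpoly_realE.
apply: continuous_prod_norm_powR => // j v; apply: cvgB; first exact: cvg_fst.
by apply: cvgD; [exact: cvg_cst|apply: cvgMr_tmp; exact: cvg_snd].
Qed.

(** Near each s and for small h > 0 the shifted product stays below [M x]: by semicontinuity where W
    T < [M x], by [gnpoly_shift_lt] at the maximum points. Compactness of a segment makes the bound
    on h uniform. *)
Lemma descent_direction (x d : 'I_n -> R) (i : 'I_n) : d i != 0 ->
  (forall s, W s * T x s = M x ->
     \forall u \near s, 0 <= \sum_j r j * d j / (u - x j)) ->
  \forall h \near 0^'+, M (fun j => x j + h * d j) < M x.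
Proof.
move=> di descent.
have local (s : R) : \forall u \near s & h \near (0 : R), 0 < h ->
    W u * T (fun j => x j + h * d j) u < M x.
  have shift0 : (fun j => x j + 0 * d j) = x.
    by apply/funext => j; rewrite mul0r addr0.
  pose z : R * R := (s, 0).
  have fst_cvg : v.1 @[v --> z] --> s by exact: cvg_fst.
  move: (le_M x s); rewrite le_eqVlt => /predU1P[sE|sM]; last first.
    suff : \forall v \near z, W v.1 * T (fun j => x j + v.2 * d j) v.1 < M x.
      by apply: filterS => v vM _.
    apply: (near_mul_lt (F := nbhs z) (W_ge0 s) _ _ _ _ _ sM) => //.
    - by move=> v; exact: gnpoly_ge0.
    - by move=> e /W_usc We; exact: (fst_cvg _ We).
    - by have := @gnpoly_shift_continuous x d z; rewrite /continuous_at /= shift0.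
    - exact: gnpoly_ge0.
  have sx : forall j, s != x j.
    apply: (gnpoly_real_root r_gt0); apply: contraTneq (M_gt0 x) => Ts0.
    by rewrite -sE Ts0 mulr0 ltxx.
  have snd_cvg : v.2 @[v --> z] --> (0 : R) by exact: cvg_snd.
  have near_sum : \forall v \near z, 0 <= \sum_j r j * d j / (v.1 - x j).
    exact: (fst_cvg _ (descent _ sE)).
  have near_neq : \forall v \near z, forall j, v.1 != x j.
    apply: (filter_forall (F := nbhs z)) => j; near=> v; rewrite -subr_eq0; near: v.
    apply: (cvgr_neq0 (s - x j)); last by rewrite subr_eq0.
    by apply: cvgB => //; exact: cvg_cst.
  have near_pos : \forall v \near z, forall j,
      0 < 1 - v.2 * d j / (v.1 - x j).
    apply: (filter_forall (F := nbhs z)) => j.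
    apply: (cvgr_gt (1 - 0 * d j / (s - x j))); last first.
      by rewrite !mul0r subr0.
    apply: cvgB; first exact: cvg_cst.
    apply: cvgM; first by apply: cvgMr_tmp.
    apply: cvgV; first by rewrite subr_eq0.
    by apply: cvgB => //; exact: cvg_cst.
  suff : \forall v \near z, 0 < v.2 ->
    W v.1 * T (fun j => x j + v.2 * d j) v.1 < M x by [].
  near=> v => v0.
  have [->|Wv] := eqVneq (W v.1) 0; first by rewrite mul0r.
  have Wv_gt0 : 0 < W v.1 by rewrite lt_neqAle eq_sym Wv W_ge0.
  apply: lt_le_trans (le_M x v.1); rewrite ltr_pM2l //.
  by apply: (gnpoly_shift_lt _ v0 di); near: v.
(* For h <= 1 the shifted roots stay within this bound, so beyond [B] the product is at most M x /
   2. *)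
have [B WB] := W_vanish (\sum_j (`|x j| + `|d j|)) (divr_gt0 (M_gt0 x) (ltr0Sn R 1)).
have : \forall h \near (0 : R), `[- B, B]%classic `<=` (fun u => 0 < h ->
    W u * T (fun j => x j + h * d j) u < M x).
  have /compact_near_coveringP coverB := @segment_compact R (- B) B.
  by apply: (coverB _ (nbhs (0 : R)) (fun h u => 0 < h ->
    W u * T (fun j => x j + h * d j) u < M x)) => s _; exact: local.
move=> inB; near=> h.
have h0 : 0 < h by near: h; exact: nbhs_right_gt.
rewrite [ltLHS]/M; set u := peak _; case: (leP `|u| B) => uB.
  have : `[- B, B]%classic `<=` (fun u => 0 < h ->
      W u * T (fun j => x j + h * d j) u < M x) by near: h; exact: cvg_within.
  by move=> /(_ u); apply => //; rewrite /= in_itv /= -ler_norml.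
have h1 : h <= 1 by near: h; exact: nbhs_right_le.
apply: le_lt_trans (WB _ _ _ uB) _ => [j|]; last by rewrite ltr_pdivrMr // ltr_pMr // ltr1n.
rewrite (le_trans (ler_normD _ _)) // [leRHS](bigD1 j) //= ler_wpDr ?sumr_ge0 //.
by rewrite lerD // normrM gtr0_norm // ler_piMl.
Unshelve. all: by end_near. Qed.

(** Distinct roots keep their order for small h by continuity; coincident roots are ordered by their
    speeds. *)
Lemma near_nondecreasing_roots (x d : 'I_n -> R) : nondecreasing_roots x ->
  (forall a b : 'I_n, (a <= b)%N -> x a = x b -> d a <= d b) ->
  \forall h \near 0^'+, nondecreasing_roots (fun j => x j + h * d j).
Proof.
move=> x_nd d_nd; apply: filter_forall => a; apply: filter_forall => b.
case: (leqP a b) => ab; last by apply: nearW.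
have := x_nd _ _ ab; rewrite le_eqVlt => /predU1P[xab|xab].
  apply: filterS (nbhs_right_gt 0) => h h0 _.
  by rewrite xab lerD2l ler_pM2l // d_nd.
have shift_cvg : (x b + h * d b) - (x a + h * d a) @[h --> 0^'+] -->
    (x b + 0 * d b) - (x a + 0 * d a).
  apply: cvg_at_right_filter.
  by apply: cvgB; (apply: cvgD; [exact: cvg_cst|apply: cvgMr_tmp; exact: cvg_id]).
have diff_gt0 : 0 < x b + 0 * d b - (x a + 0 * d a) by rewrite !mul0r !addr0 subr_gt0.
by apply: filterS (cvgr_gt _ shift_cvg 0 diff_gt0) => h /ltW + _; rewrite subr_ge0.
Qed.

(** * Roots and maximum points of a minimizer *)

Section minimizer.
Context (x : 'I_n -> R).
Hypothesis x_nd : nondecreasing_roots x.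
Hypothesis x_min : forall x', nondecreasing_roots x' -> M x <= M x'.

Let root_free s j : W s * T x s = M x -> s != x j.
Proof.
move=> sE; apply: (gnpoly_real_root r_gt0); apply: contraTneq (M_gt0 x) => Ts0.
by rewrite -sE Ts0 mulr0 ltxx.
Qed.

Let no_descent (d : 'I_n -> R) (i : 'I_n) : d i != 0 ->
  (forall a b : 'I_n, (a <= b)%N -> x a = x b -> d a <= d b) ->
  exists2 s, W s * T x s = M x &
    ~ \forall u \near s, 0 <= \sum_j r j * d j / (u - x j).
Proof.
move=> di d_nd; apply: contrapT => noE.
have descent s : W s * T x s = M x ->
    \forall u \near s, 0 <= \sum_j r j * d j / (u - x j).
  by move=> sE; apply: contrapT => ns; apply: noE; exists s.
have near_ndecr := near_nondecreasing_roots x_nd d_nd.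
have [h [xhM /x_min]] := filter_ex (filterI (descent_direction di descent) near_ndecr).
by rewrite leNgt xhM.
Qed.

(* Speeds inversely proportional to the exponents: moving the roots x_a and x_b
   apart then makes the logarithmic derivative of T the difference of two simple
   fractions in spread_sum. *)
Let spread (a b : 'I_n) (alpha beta : R) (j : 'I_n) : R :=
  ((j == b)%:R * beta - (j == a)%:R * alpha) / r j.

Let spread_sum (a b : 'I_n) (alpha beta u : R) :
  \sum_j r j * spread a b alpha beta j / (u - x j) =
  beta / (u - x b) - alpha / (u - x a).
Proof.
have delta (c : 'I_n) (g : R) :
    \sum_(j < n) (j == c)%:R * g / (u - x j) = g / (u - x c).
  rewrite (bigD1 c) //= eqxx mul1r big1 ?addr0 // => j /negPf ->.
  by rewrite !mul0r.
rewrite -!delta -sumrB; apply: eq_bigr => j _; rewrite /spread mulrC.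
by have := gt_eqF (r_gt0 j) => /negbT rj; rewrite (mulrC (r j)) divfK // -mulrBl mulrC.
Qed.

(** When two equal roots are spread apart, the two simple fractions of [spread_sum] cancel, so the
    derivative condition holds near every point, against minimality. *)
Let x_incr : strictly_increasing x.
Proof.
suff x_inj a b : x a = x b -> a = b.
  move=> i j ij; rewrite lt_neqAle x_nd ?(ltnW ij) // andbT.
  by apply: contraTneq ij => /x_inj ->; rewrite ltnn.
wlog ab : a b / (a < b)%N.
  move=> wl xab; case: (ltngtP a b) => [ab|ba|]; last exact: val_inj.
    exact: wl.
  by apply/esym/wl.
move=> xab; exfalso.
(* The extreme indices of the cluster of equal roots are the ones to move: the speeds are then
   nondecreasing along the cluster, so the order of the roots is kept. *)
pose lo := [arg min_(i < a | x i == x a) (i : nat)].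
pose hi := [arg max_(i > a | x i == x a) (i : nat)].
have [/eqP x_lo lo_min] : x lo == x a /\ forall i, x i = x a -> (lo <= i)%N.
  by rewrite /lo; case: arg_minnP => // i xi imin; split => // j /eqP; exact: imin.
have [/eqP x_hi hi_max] : x hi == x a /\ forall i, x i = x a -> (i <= hi)%N.
  by rewrite /hi; case: arg_maxnP => // i xi imax; split => // j /eqP; exact: imax.
have lohi : (lo < hi)%N.
  by rewrite (leq_ltn_trans (lo_min a erefl)) // (leq_trans ab) // hi_max.
have lohiF : (lo == hi) = false by apply: ltn_eqF.
have [||s _ []] := @no_descent (spread lo hi 1 1) lo.
- by rewrite /spread eqxx lohiF mul0r mul1r add0r mulf_neq0 ?invr_eq0 ?oppr_eq0 ?oner_eq0 ?gt_eqF.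
- move=> i j ij xij; rewrite /spread !mulr1.
  have [ihi|ihi] := eqVneq i hi.
    have jhi : j = hi.
      by apply: val_inj; apply/eqP; rewrite eqn_leq -{2}ihi ij hi_max // -xij ihi.
    by rewrite ihi jhi eqxx.
  have [jlo|jlo] := eqVneq j lo.
    have ilo : i = lo.
      by apply: val_inj; apply/eqP; rewrite eqn_leq -{1}jlo ij lo_min // xij jlo.
    by rewrite ilo jlo lohiF eqxx.
  apply: (@le_trans _ _ 0).
    by rewrite sub0r mulNr oppr_le0 divr_ge0 // ?ler0n // ltW.
  by rewrite subr0 divr_ge0 // ?ler0n // ltW.
- by near=> u; rewrite spread_sum x_lo x_hi subrr.
Unshelve. all: by end_near. Qed.

Let no_spread (a b : 'I_n) (alpha beta : R) (i : 'I_n) :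
  (i == b)%:R * beta - (i == a)%:R * alpha != 0 ->
  exists2 s, W s * T x s = M x &
    ~ \forall u \near s, 0 <= beta / (u - x b) - alpha / (u - x a).
Proof.
move=> i0; have [||s sE ns] := @no_descent (spread a b alpha beta) i.
- by rewrite /spread mulf_neq0 // invr_eq0 gt_eqF.
- by move=> c d _ /(strictly_increasing_inj x_incr) ->.
exists s; first exact: sE.
by move=> nu; apply: ns; apply: filterS nu => u; rewrite spread_sum.
Qed.

(** With x_a < x_b, 1 / (u - x_b) - 1 / (u - x_a) is nonnegative to the left of x_a and to the right
    of x_b. Since this sign fails arbitrarily close to some maximum point, that point lies
    between. *)
Let peak_in_gap (k : 'I_n.+1) : (0 < n)%N -> exists2 s, W s * T x s = M x &
  (forall j : 'I_n, (j < k)%N -> x j < s) /\ (forall j : 'I_n, (k <= j)%N -> s < x j).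
Proof.
move=> n_gt0; case: (posnP k) => [k0|k_gt0].
  pose o := Ordinal n_gt0.
  (* Only the first root moves, to the right; its fraction is nonnegative to the right of the root,
     so the point lies to its left. For k = n the last root moves to the left. *)
  have [|s sE ns] := @no_spread o o 0 1 o.
    by rewrite eqxx !mul1r subr0 oner_eq0.
  exists s; first exact: sE.
  rewrite k0; split => [//|j _]; have oj : (o <= j)%N by exact: leq0n.
  apply: lt_le_trans (x_nd oj).
  rewrite lt_neqAle root_free //= leNgt; apply/negP => os; apply: ns.
  near=> u; rewrite mul0r subr0 mul1r invr_ge0 subr_ge0 ltW //; near: u.
  exact: lt_nbhsr.
have a_lt : (k.-1 < n)%N by rewrite -ltnS prednK.
pose a := Ordinal a_lt.
have le_a (j : 'I_n) : (j < k)%N -> x j <= x a.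
  by move=> jk; apply: x_nd; rewrite /= -ltnS prednK.
case: (ltnP k n) => kn; last first.
  have [|s sE ns] := @no_spread a a 1 0 a.
    by rewrite eqxx !mul1r sub0r oppr_eq0 oner_eq0.
  exists s; first exact: sE.
  split => [j /le_a xj|j]; last by rewrite leqNgt (leq_trans (ltn_ord j)).
  apply: (le_lt_trans xj).
  rewrite lt_neqAle eq_sym root_free //= leNgt; apply/negP => os; apply: ns.
  near=> u; rewrite mul0r sub0r mul1r oppr_ge0 invr_le0 subr_le0 ltW //; near: u.
  exact: lt_nbhsl.
pose b := Ordinal kn.
have ab : x a < x b by apply: x_incr; rewrite /= prednK.
have [|s sE ns] := @no_spread a b 1 1 a.
  rewrite eqxx !mulr1 (_ : (a == b) = false) ?sub0r ?oppr_eq0 ?oner_eq0 //.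
  by apply/negP => /eqP aE; move: ab; rewrite aE ltxx.
exists s; first exact: sE.
split => [j /le_a xj|j kj].
  apply: (le_lt_trans xj).
  rewrite lt_neqAle eq_sym root_free //= leNgt; apply/negP => os; apply: ns.
  near=> u; have ua : u < x a by near: u; exact: lt_nbhsl.
  have ub : u < x b by exact: lt_trans ab.
  rewrite !mul1r subr_ge0 -lerN2 -!invrN !opprB lef_pV2 ?posrE ?subr_gt0 //.
  by rewrite lerD2r ltW.
have bj : (b <= j)%N by exact: kj.
apply: lt_le_trans (x_nd bj).
rewrite lt_neqAle root_free //= leNgt; apply/negP => os; apply: ns.
near=> u; have bu : x b < u by near: u; exact: lt_nbhsr.
have au : x a < u by exact: lt_trans bu.
rewrite !mul1r subr_ge0 lef_pV2 ?posrE ?subr_gt0 //.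
by rewrite lerD2l lerN2 ltW.
Unshelve. all: by end_near. Qed.

Lemma minimizer_equioscillates : (0 < n)%N -> strictly_increasing x /\
  exists t : 'I_n.+1 -> R, [/\ strictly_increasing t,
    forall j : 'I_n, t (widen_ord (leqnSn n) j) < x j < t (lift ord0 j),
    forall k s, W s * T x s <= W (t k) * T x (t k)
    & forall k, 0 < W (t k) * T x (t k)].
Proof.
move=> n_gt0; split => //.
have /choice[t tP] : forall k : 'I_n.+1, exists s, W s * T x s = M x /\
    ((forall j : 'I_n, (j < k)%N -> x j < s) /\ (forall j : 'I_n, (k <= j)%N -> s < x j)).
  by move=> k; have [s sE gap] := peak_in_gap k n_gt0; exists s.
exists t; split => [k l kl|j|k s|k].
- have kn : (k < n)%N by rewrite (leq_trans kl) // -ltnS.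
  have [_ [_ /(_ (Ordinal kn) (leqnn _)) tk]] := tP k.
  by have [_ [/(_ (Ordinal kn) kl) tl _]] := tP l; exact: lt_trans tl.
- have [_ [_ ->//]] := tP (widen_ord (leqnSn n) j).
  by have [_ [-> //]] := tP (lift ord0 j).
- by have [-> _] := tP k; exact: le_M.
- by have [-> _] := tP k; exact: M_gt0.
Qed.

End minimizer.

Lemma exists_equioscillation : (0 < n)%N -> exists (x : 'I_n -> R) (t : 'I_n.+1 -> R),
  [/\ strictly_increasing x, strictly_increasing t,
    forall j : 'I_n, t (widen_ord (leqnSn n) j) < x j < t (lift ord0 j),
    forall k s, W s * T x s <= W (t k) * T x (t k)
    & forall k, 0 < W (t k) * T x (t k)].
Proof.
move=> n_gt0; have [x x_nd x_min] := exists_minimizer.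
have [x_incr [t [t_incr tx t_max t_gt0]]] := minimizer_equioscillates x_nd x_min n_gt0.
by exists x, t.
Qed.

End minimization.

(** * Extremality *)

Lemma prod_powR_exponents (R : realType) (n : nat) (r : 'I_n -> R) (a : R) : 0 < a ->
  \prod_(j < n) a `^ r j = a `^ (\sum_(j < n) r j).
Proof.
move=> a0; rewrite [RHS]/powR gt_eqF // mulr_suml expR_sum.
by apply: eq_bigr => j _; rewrite /powR gt_eqF.
Qed.

Lemma weighted_gnpoly_vanish (R : realType) (n : nat) (r : 'I_n -> R) (w : R -> R)
  (r_gt0 : forall j : 'I_n, 0 < r j)
  (w_ge0 : forall s : R, 0 <= w s)
  (w_bounded_above : has_ubound (range w))
  (w_lim_pinfty :
    w s * `|s| `^ (\sum_(j < n) r j) @[s --> +oo] --> (0 : R))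
  (w_lim_ninfty :
    w s * `|s| `^ (\sum_(j < n) r j) @[s --> -oo] --> (0 : R)) (C e : R) : 0 < e ->
  exists B : R, forall x : 'I_n -> R, (forall j, `|x j| <= C) ->
    forall s, B < `|s| -> usc_envelope w s * gnpoly r x (fun=> 0) s <= e.
Proof.
move=> e0; set rho := \sum_(j < n) r j in w_lim_pinfty w_lim_ninfty.
(* Beyond a bound that is at least |C|, |u - x_j| <= 2|u| and hence T(u) <= 2^rho |u|^rho; this
   accounts for the factor 2^rho. *)
have e2 : 0 < e / 2 `^ rho by rewrite divr_gt0 // powR_gt0.
have [Bp [_ wBp]] := cvgr_le _ w_lim_pinfty _ e2.
have [Bn [_ wBn]] := cvgr_le _ w_lim_ninfty _ e2.
pose B := `|Bp| + `|Bn| + `|C|.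
exists B => x xC s sB.
apply: usc_envelope_mul_le => //; [exact: gnpoly_ge0|exact: gnpoly_continuous|].
near=> u.
have uB : B < `|u| by near: u; apply: (cvgr_gt `|s|) => //; exact: norm_continuous.
have u0 : 0 < `|u| by apply: le_lt_trans uB; rewrite !addr_ge0.
have wu : w u * `|u| `^ rho <= e / 2 `^ rho.
  have := normr_ge0 Bp; have := normr_ge0 Bn; have := normr_ge0 C => c0 bn bp.
  case: (leP 0 u) => u_ge0.
    apply: wBp; rewrite -(ger0_norm u_ge0) (le_lt_trans (ler_norm Bp)) //.
    by apply: le_lt_trans uB; rewrite /B; lra.
  apply: wBn; rewrite -[u]opprK -(ltr0_norm u_ge0) ltrNl (le_lt_trans (ler_norm _)) // normrN.
  by apply: le_lt_trans uB; rewrite /B; lra.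
rewrite gnpoly_realE; apply: (@le_trans _ _ (w u * (2 `^ rho * `|u| `^ rho))); last first.
  by rewrite mulrCA mulrC -ler_pdivlMr ?powR_gt0.
rewrite ler_wpM2l // -powRM // -prod_powR_exponents ?mulr_gt0 //.
apply: ler_prod => j _; rewrite powR_ge0 /= ge0_ler_powR ?nnegrE ?mulr_ge0 //; first exact: ltW.
rewrite (le_trans (ler_normB _ _)) // mulr_natl mulr2n lerD2l (le_trans (xC j)) //.
rewrite (le_trans (ler_norm C)) // (le_trans _ (ltW uB)) // lerDr addr_ge0 //.
Unshelve. all: by end_near. Qed.

Lemma supported_nodes (R : realType) (n : nat) (w : R -> R) :
  (forall s : R, 0 <= w s) -> (`I_n.+1 #<= [set s : R | w s != 0])%card ->
  exists2 p : 'I_n.+1 -> R, injective p & forall k, 0 < w (p k).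
Proof.
move=> w_ge0 /pcard_leP[f]; exists (fun k : 'I_n.+1 => f k).
  move=> k l /= fkl; apply/val_inj/(@inj _ _ _ f) => //; rewrite inE /=.
  - by [].
  - by [].
by move=> k; rewrite lt_neqAle eq_sym w_ge0 andbT; apply: (@funS _ _ _ _ f); rewrite /=.
Qed.

Lemma extremalP (R : realType) (n : nat) (r : 'I_n -> R) (w T : R -> R) :
  gnpolys r T ->
  extremal r w T <-> forall P, gnpolys r P -> (supnorm (w \* T)%R <= supnorm (w \* P)%R)%E.
Proof.
move=> gT; split=> [[_ TE] P gP|le_sup].
  rewrite TE; apply: ereal_inf_lbound.
  exact: (imageP (fun P => supnorm (w \* P)) gP).
split; first exact: gT.
apply/le_anti/andP; split.
  by apply: le_ereal_inf_tmp => _ [P gP <-]; exact: le_sup.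
apply: ereal_inf_lbound; exact: (imageP (fun P => supnorm (w \* P)) gT).
Qed.

Section extremality.
Context (R : realType) (n : nat) (r : 'I_n -> R) (w : R -> R).
Hypothesis r_gt0 : forall j, 0 < r j.
Hypothesis w_ge0 : forall s, 0 <= w s.
Hypothesis w_bounded_above : has_ubound (range w).
Local Notation W := (usc_envelope w).
Local Notation T x := (gnpoly r x (fun=> 0)).

(** Since W > 0 at each t_k, a competitor of norm at most m is at most T there, and interlacing
    forces its real parts to be x. A nonzero imaginary part would then make it exceed T at t_0. *)
Lemma equioscillating_strict_min (x : 'I_n -> R) (t : 'I_n.+1 -> R) (m : R) :
  0 < m -> strictly_increasing x -> strictly_increasing t ->
  (forall j : 'I_n, t (widen_ord (leqnSn n) j) < x j < t (lift ord0 j)) ->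
  (forall k, W (t k) * T x (t k) = m) ->
  forall x' y', strictly_increasing x' -> (supnorm (w \* gnpoly r x' y')%R <= m%:E)%E ->
  x = x' /\ forall j, y' j = 0.
Proof.
move=> m0 x_incr t_incr tx tm x' y' x'_incr.
move/(supnorm_le w_ge0 w_bounded_above (gnpoly_ge0 _ _ _)
  (@gnpoly_continuous _ _ _ r_gt0 _ _)) => le_m.
have Wt0 k : 0 < W (t k).
  rewrite lt_neqAle eq_sym usc_envelope_ge0 // andbT.
  by apply: contraTneq m0 => Wt; rewrite -(tm k) Wt mul0r ltxx.
have le_T k : gnpoly r x' y' (t k) <= T x (t k).
  by rewrite -(ler_pM2l (Wt0 k)) tm le_m.
have xx' : x = x'.
  apply/funext; apply: (interlacing_prod_le_eq t_incr tx _ r_gt0).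
    move=> i j; rewrite leq_eqVlt => /predU1P[/val_inj->//|ij].
    exact/ltW/x'_incr.
  move=> k; rewrite -!gnpoly_realE; apply: le_trans (le_T k).
  exact: gnpoly_real_le.
split=> // j; apply/eqP/negPn/negP => yj.
have := le_T ord0; rewrite leNgt => /negP; apply; rewrite xx'.
apply: (gnpoly_real_lt r_gt0) yj; rewrite -xx'; apply: (gnpoly_real_root r_gt0).
by apply: contraTneq m0 => Tt; rewrite -(tm ord0) Tt mulr0 ltxx.
Qed.

Lemma equioscillating_extremal (x : 'I_n -> R) (t : 'I_n.+1 -> R) (m : R) :
  0 < m -> strictly_increasing x -> strictly_increasing t ->
  (forall j : 'I_n, t (widen_ord (leqnSn n) j) < x j < t (lift ord0 j)) ->
  (forall k, W (t k) * T x (t k) = m) -> supnorm (w \* T x) = m%:E ->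
  extremal r w (T x) /\
  forall x' y', strictly_increasing x' -> extremal r w (gnpoly r x' y') ->
    x = x' /\ forall j, y' j = 0.
Proof.
move=> m0 x_incr t_incr tx tm supnorm_m.
have unique := equioscillating_strict_min m0 x_incr t_incr tx tm.
have x_gn : gnpolys r (T x) by exists x, (fun=> 0).
split=> [|x' y' x'_incr].
  apply/(extremalP _ x_gn) => _ [x' [y' [x'_incr ->]]].
  rewrite leNgt; apply/negP => lt_supnorm.
  have [|xx' y'0] := unique x' y' x'_incr; first by rewrite -supnorm_m ltW.
  have y'E : y' = (fun=> 0) by apply/funext.
  by move: lt_supnorm; rewrite xx' y'E ltxx.
have x'_gn : gnpolys r (gnpoly r x' y') by exists x', y'.
move=> /(extremalP _ x'_gn)/(_ _ x_gn); rewrite supnorm_m; exact: unique.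
Qed.

End extremality.

Theorem corollary7p1 (R : realType) (n : nat) (r : 'I_n -> R) (w : R -> R)
  (n_gt0 : (0 < n)%N)
  (r_gt0 : forall j : 'I_n, 0 < r j)
  (w_ge0 : forall s : R, 0 <= w s)
  (w_bounded_above : has_ubound (range w))
  (w_support : (`I_n.+1 #<= [set s : R | w s != 0])%card)
  (w_lim_pinfty :
    w s * `|s| `^ (\sum_(j < n) r j) @[s --> +oo] --> (0 : R))
  (w_lim_ninfty :
    w s * `|s| `^ (\sum_(j < n) r j) @[s --> -oo] --> (0 : R)) :
  [/\ exists! T : R -> R, extremal r w T,
      (* the roots of an extremal T, in any representation, are real and
         distinct *)
      forall T : R -> R, extremal r w T ->
        forall x y : 'I_n -> R, strictly_increasing x -> T = gnpoly r x y ->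
          (forall j : 'I_n, y j = 0) /\ injective x,
      forall T : R -> R,
        extremal r w T <-> equioscillates r T (approaches_norm (w \* T))
    & upper_semicontinuous w -> forall T : R -> R,
        extremal r w T <-> equioscillates r T (attains_norm (w \* T))].
Proof.
set W := usc_envelope w.
have W_ge0 : forall s, 0 <= W s by exact: usc_envelope_ge0.
have gn_ge0 := @gnpoly_ge0 _ n r.
have gn_cont := gnpoly_continuous r_gt0.
have vanish := weighted_gnpoly_vanish r_gt0 w_ge0 w_bounded_above w_lim_pinfty w_lim_ninfty.
have [p p_inj wp] := supported_nodes w_ge0 w_support.
have Wp k : 0 < W (p k) by apply: lt_le_trans (wp k) _; exact: usc_envelope_ge.
have [x [t [x_incr t_incr tx t_max t_gt0]]] :=
  exists_equioscillation r_gt0 W_ge0 (@usc_envelope_usc _ _ w_bounded_above) vanish p_inj Wp n_gt0.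
have supnorm_t (k : 'I_n.+1) : supnorm (w \* gnpoly r x (fun=> 0)) =
    (W (t k) * gnpoly r x (fun=> 0) (t k))%:E.
  exact: (supnorm_argmax w_ge0 w_bounded_above (gn_ge0 _ _) (gn_cont _ _) (t_max k)).
(* Used twice: for the pair (x, t) just found, and for the roots and points of an arbitrary
   equioscillating function. *)
have extremal_of (x0 : 'I_n -> R) (t0 : 'I_n.+1 -> R) :
    strictly_increasing x0 -> strictly_increasing t0 ->
    (forall j : 'I_n, t0 (widen_ord (leqnSn n) j) < x0 j < t0 (lift ord0 j)) ->
    (forall k, (W (t0 k) * gnpoly r x0 (fun=> 0) (t0 k))%:E =
               supnorm (w \* gnpoly r x0 (fun=> 0))) ->
    extremal r w (gnpoly r x0 (fun=> 0)) /\
    forall x1 y1, strictly_increasing x1 -> extremal r w (gnpoly r x1 y1) ->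
      x0 = x1 /\ forall j, y1 j = 0.
  move=> x0_incr t0_incr t0x t0_peak.
  pose m := W (t0 ord0) * gnpoly r x0 (fun=> 0) (t0 ord0).
  have supnorm_m : supnorm (w \* gnpoly r x0 (fun=> 0)) = m%:E by rewrite -(t0_peak ord0).
  have m_gt0 : 0 < m.
    (* By pigeonhole some support point [p k] is not a root, so the norm is positive. *)
    have [d [d_gt0 /(far_node x0)[k kx]]] :=
      filter_ex (filterI (nbhs_right_gt 0) (near_injective_gap p_inj)).
    have /(supnorm_le w_ge0 w_bounded_above (gn_ge0 _ _) (gn_cont _ _))/(_ (p k)) :
      (supnorm (w \* gnpoly r x0 (fun=> 0))%R <= m%:E)%E by rewrite supnorm_m.
    apply: lt_le_trans; rewrite mulr_gt0 // gnpoly_real_gt0 // => j.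
    by rewrite -subr_eq0 -normr_gt0 (lt_le_trans d_gt0).
  have t0_m k : W (t0 k) * gnpoly r x0 (fun=> 0) (t0 k) = m.
    by have := t0_peak k; rewrite supnorm_m => -[].
  exact: (equioscillating_extremal r_gt0 w_ge0 w_bounded_above m_gt0
    x0_incr t0_incr t0x t0_m supnorm_m).
have [T_extremal T_unique] := extremal_of x t x_incr t_incr tx (fun k => esym (supnorm_t k)).
have extremal_eq T : extremal r w T -> T = gnpoly r x (fun=> 0).
  move=> T_ext; have [[x1 [y1 [x1_incr TE]]] _] := T_ext.
  rewrite TE in T_ext *; have [-> y10] := T_unique _ _ x1_incr T_ext.
  by congr gnpoly; apply/funext.
(* The equivalence is proved once, for any notion of peak that amounts to [W] times T attaining the
   norm. *)
have extremal_iff (peak : (R -> R) -> R -> Prop) :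
    (forall x0 s, peak (w \* gnpoly r x0 (fun=> 0)) s <->
       (W s * gnpoly r x0 (fun=> 0) s)%:E = supnorm (w \* gnpoly r x0 (fun=> 0))) ->
    forall T, extremal r w T <-> equioscillates r T (peak (w \* T)).
  move=> peakE T; split=> [/extremal_eq ->|[x0 [t0 [[x0_incr ->] t0_incr t0x peak0]]]].
    by exists x, t; split => // k; apply/peakE; rewrite -supnorm_t.
  exact: (extremal_of x0 t0 x0_incr t0_incr t0x (fun k => (peakE _ _).1 (peak0 k))).1.
split.
- exists (gnpoly r x (fun=> 0)); split; first exact: T_extremal.
  by move=> T /extremal_eq ->.
- move=> T T_ext x1 y1 x1_incr TE; rewrite TE in T_ext.
  have [_ y10] := T_unique _ _ x1_incr T_ext.
  by split; [exact: y10|exact: strictly_increasing_inj].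
- apply: (extremal_iff (@approaches_norm R)) => x0 s; rewrite /approaches_norm.
  by rewrite (limf_esup_usc_envelope w_ge0 w_bounded_above (gn_ge0 _ _) (gn_cont _ _)).
- move=> w_usc; apply: (extremal_iff (@attains_norm R)) => x0 s; rewrite /attains_norm.
  (* Upper semicontinuity gives w <= w s + e near s, so the envelope at s is [w s]. *)
  suff -> : W s = w s by rewrite ger0_norm // mulr_ge0.
  apply/eqP; rewrite eq_le usc_envelope_ge // andbT.
  apply/ler_addgt0Pr => e e_gt0; apply: usc_envelope_le => //.
  have [|V Vs V_lt] := w_usc s (- (w s + e)); first by rewrite lte_fin ltrN2 ltrDl.
  by apply: filterS Vs => u /V_lt; rewrite lte_fin ltrN2 => /ltW.
Qed.
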